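(* For $\boldsymbol\alpha=(\alpha_x,\alpha_y,\alpha_z)$ and a pure qubit state $\boldsymbol\phi$ of $A$, let $\mathcal N_{\boldsymbol\phi}^{E\to B}(\omega)=\mathrm{Tr}_F(U_{\boldsymbol\alpha}(\boldsymbol\phi\otimes\omega)U_{\boldsymbol\alpha}^\dagger)$ and let $\mathbb H_2(B|F)_\rho$ be the associated conditional Rényi entropy of order 2 (see context). (i) If $\boldsymbol\alpha=(0,0,0)$ (Identity), then $\mathbb H_2(B|F)_\rho\le 0$ for every pure $\boldsymbol\phi$. (ii) If $\boldsymbol\alpha=(\frac\pi2,0,0)$ (CNOT), then $\mathbb H_2(B|F)_\rho\le 0$ for every pure $\boldsymbol\phi$. (iii) If $\boldsymbol\alpha=(\frac\pi2,\frac\pi2,\frac\pi2)$ (SWAP), then the maximum of $\mathbb H_2(B|F)_\rho$ over pure states $\boldsymbol\phi$ equals $1$ and is attained at $\boldsymbol\phi=|0\rangle\langle0|$. (iv) If $\boldsymbol\alpha=(\frac\pi2,\frac\pi2,0)$ (DCNOT), then the maximum of $\mathbb H_2(B|F)_\rho$ over pure states $\boldsymbol\phi$ equals $1$ and is attained at $\boldsymbol\phi=|0\rangle\langle0|$. Consequently, in cases (iii) and (iv), with $\boldsymbol\phi=|0\rangle\langle 0|$, for every $0<\epsilon\le 2$ and every integer $n\ge1$, $$\frac1n Q^\epsilon\big((\mathcal N_{\boldsymbol\phi}^{E\to B})^{\otimes n}\big)\ge 1-\frac1n g\big(\sqrt{\epsilon/2}-\delta_\star\big)-\frac4n\log_2\frac1{\delta_\star}-\frac2n,$$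 where $\delta_\star$ minimizes $g(\sqrt{\epsilon/2}-\delta)-4\log_2\delta$ over $\delta\in(0,\sqrt{\epsilon/2})$.
   Context: All systems $A,B,E,F$ are qubits, $A\simeq B$, $E\simeq F$. In the basis $\{|0\rangle_A|0\rangle_E,|0\rangle_A|1\rangle_E,|1\rangle_A|0\rangle_E,|1\rangle_A|1\rangle_E\}$ (the output factors are $B$ first, $F$ second), $$U_{\boldsymbol\alpha}=\begin{pmatrix}\cos\frac{\alpha_x-\alpha_y}{2}&0&0&-i\sin\frac{\alpha_x-\alpha_y}{2}\\0&e^{i\alpha_z}\cos\frac{\alpha_x+\alpha_y}{2}&-ie^{i\alpha_z}\sin\frac{\alpha_x+\alpha_y}{2}&0\\0&-ie^{i\alpha_z}\sin\frac{\alpha_x+\alpha_y}{2}&e^{i\alpha_z}\cos\frac{\alpha_x+\alpha_y}{2}&0\\-i\sin\frac{\alpha_x-\alpha_y}{2}&0&0&\cos\frac{\alpha_x-\alpha_y}{2}\end{pmatrix}.$$ The complementary channel is $(\mathcal N_{\boldsymbol\phi}^{E\to B})^c(\omega)=\mathrm{Tr}_B\big(U_{\boldsymbol\alpha}(\boldsymbol\phi\otimes\omega)U_{\boldsymbol\alpha}^\dagger\big)$, with output $F$. The state $\rho=\rho_{BF}:=(\mathrm{id}\otimes(\mathcal N_{\boldsymbol\phi}^{E\to B})^c)(\Phi)$, where $\Phi$ is a maximally entangled state of a reference qubit and $E$; the reference qubit is left untouched and is labelled $B$ in $\rho_{BF}$. Conditional Rényi entropy of order 2: $\mathbb H_2(B|F)_\rho=\sup_{\sigma_F}\big(-\log_2\mathrm{Tr}\{[(I_B\otimes\sigma_F)^{-1/4}\rho_{BF}(I_B\otimes\sigma_F)^{-1/4}]^2\}\big)$,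 the supremum being over positive definite density operators $\sigma_F$ on $F$. One-shot quantum capacity: for a channel $\mathcal M$ from $\mathcal H_E^{\otimes n}$ to $\mathcal H_B^{\otimes n}$, $Q^\epsilon(\mathcal M)=\max\{\log_2 m : F_{\min}(\mathcal M,m)\ge 1-\epsilon\}$, with $$F_{\min}(\mathcal M,m)=\max_{\mathcal H'\subset\mathcal H_E^{\otimes n},\,\dim\mathcal H'=m}\ \max_{\mathcal D}\ \min_{|\omega\rangle\in\mathcal H',\,\|\omega\|=1}\langle\omega|(\mathcal D\circ\mathcal M)(|\omega\rangle\langle\omega|)|\omega\rangle,$$ where $\mathcal D$ ranges over completely positive trace-preserving maps from operators on $\mathcal H_B^{\otimes n}$ to operators on $\mathcal H'$. $g(\epsilon):=-\log_2\big(1-\sqrt{1-\epsilon^2}\big)$. *)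

(* Defs.v *)
(* A ket of C^d is a column vector 'cV[R[i]]_d, an operator is a matrix.
   The computational basis of a tensor product is ordered by mxtens_index,
   (i, j) |-> i * (dimension of the second factor) + j, which for two qubits is
   |00>, |01>, |10>, |11>. *)
From HB Require Import structures.
From mathcomp Require Import all_boot all_order all_algebra.
From mathcomp Require Import all_classical all_reals all_analysis.
From mathcomp Require Import complex mxtens.

Set Implicit Arguments.
Unset Strict Implicit.
Unset Printing Implicit Defensive.

Import Order.TTheory GRing.Theory Num.Theory.

Local Open Scope classical_set_scope.
Local Open Scope ring_scope.
Local Open Scope complex_scope.

Section Operators.
Variable R : realType.
Local Notation C := R[i].

Definition adjmx m n (A : 'M[C]_(m, n)) : 'M[C]_(n, m) := map_mx (@conjc R) A^T.

Definition braket d (v w : 'cV[C]_d) : C := (adjmx v *m w) 0 0.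

Definition ketbra d (v w : 'cV[C]_d) : 'M[C]_d := v *m adjmx w.

(* The order of R[i] makes 0 <= z (resp. 0 < z) entail that z is real, hence
   these predicates entail that A is Hermitian. *)
Definition psd d (A : 'M[C]_d) : Prop := forall v, 0 <= braket v (A *m v).

Definition posdef d (A : 'M[C]_d) : Prop :=
  forall v, v != 0 -> 0 < braket v (A *m v).

Definition pure_state d (A : 'M[C]_d) : Prop :=
  exists2 v : 'cV[C]_d, braket v v = 1 & A = ketbra v v.

Definition ptrace1 m n (X : 'M[C]_(m * n)) : 'M[C]_n :=
  \matrix_(i, j) \sum_(k < m) X (mxtens_index (k, i)) (mxtens_index (k, j)).

Definition ptrace2 m n (X : 'M[C]_(m * n)) : 'M[C]_m :=
  \matrix_(i, j) \sum_(k < n) X (mxtens_index (i, k)) (mxtens_index (j, k)).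

(* A ^ s for Hermitian A with positive eigenvalues. A = P^-1 *m diag *m P with
   P unitary for the chosen diagonalization (orthomx_spectralP); the result
   does not depend on that choice. *)
Definition mxpowR d (A : 'M[C]_d) (s : R) : 'M[C]_d :=
  invmx (spectralmx A)
    *m diag_mx (map_mx (fun z : C => (powR (complex.Re z) s)%:C)
                  (spectral_diag A))
    *m spectralmx A.

(* f (x) g, by expansion of X in the basis (|i><j| (x) |k><l|). *)
Definition tens_map a b c d (f : 'M[C]_a -> 'M[C]_b) (g : 'M[C]_c -> 'M[C]_d)
    (X : 'M[C]_(a * c)) : 'M[C]_(b * d) :=
  \sum_(i < a) \sum_(j < a) \sum_(k < c) \sum_(l < c)
    X (mxtens_index (i, k)) (mxtens_index (j, l))
      *: (f (delta_mx i j) *t g (delta_mx k l)).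

(* The case split mirrors the library's ntensmx: a ^ k.+2 is convertible to
   a * a ^ k.+1, but a ^ k.+1 is not convertible to a * a ^ k. *)
Fixpoint tens_pow_rec (a b : nat) (f : 'M[C]_a -> 'M[C]_b) k :
    'M[C]_(a ^ k.+1) -> 'M[C]_(b ^ k.+1) :=
  if k is k'.+1 return 'M[C]_(a ^ k.+1) -> 'M[C]_(b ^ k.+1)
  then tens_map f (@tens_pow_rec a b f k') else f.

Definition tens_pow (a b : nat) (f : 'M[C]_a -> 'M[C]_b) n :
    'M[C]_(a ^ n) -> 'M[C]_(b ^ n) :=
  if n is k.+1 return 'M[C]_(a ^ n) -> 'M[C]_(b ^ n)
  then @tens_pow_rec a b f k else id.

Definition completely_positive a b (f : 'M[C]_a -> 'M[C]_b) : Prop :=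
  forall (k : nat) (X : 'M[C]_(k * a)),
    psd X -> psd (tens_map (@id 'M[C]_k) f X).

Definition trace_preserving a b (f : 'M[C]_a -> 'M[C]_b) : Prop :=
  forall X, \tr (f X) = \tr X.

(* Bases of both factors are arbitrary: the columns of V and of W. *)
Definition maximally_entangled d (Phi : 'M[C]_(d * d)) : Prop :=
  exists V W : 'M[C]_d, [/\ V \is unitarymx, W \is unitarymx &
    Phi = d%:R^-1 *: \sum_(i < d) \sum_(j < d)
            (ketbra (col i V) (col j V) *t ketbra (col i W) (col j W))].

End Operators.

Arguments tens_pow {R a b} f n X.

Section Entropy.
Variable R : realType.
Local Notation C := R[i].

Definition log2 (x : R) : R := ln x / ln 2.

Definition condH2 b f (rho : 'M[C]_(b * f)) : \bar R :=
  ereal_sup [set (let S := mxpowR (1%:M *t sigma : 'M[C]_(b * f)) (- 4^-1) in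
                  - log2 (complex.Re (\tr ((S *m rho *m S) ^+ 2))))%:E
            | sigma in [set sigma : 'M[C]_f | posdef sigma /\ \tr sigma = 1]].

End Entropy.

Section Capacity.
Variable R : realType.
Local Notation C := R[i].

(* Y is an operator on H, extended by 0 to the orthogonal complement of H. *)
Definition operator_on d (H : {vspace 'cV[C]_d}) (Y : 'M[C]_d) : Prop :=
  (forall v : 'cV[C]_d, Y *m v \in H) /\
  (forall v : 'cV[C]_d, (forall w, w \in H -> braket w v = 0) -> Y *m v = 0).

Definition decoder b d (H : {vspace 'cV[C]_d})
    (D : {linear 'M[C]_b -> 'M[C]_d}) : Prop :=
  [/\ completely_positive D, trace_preserving D & forall X, operator_on H (D X)].

(* The suprema and the infimum are attained when the sets are nonempty, by
   compactness. Over \bar R, a dimension m > d, for which there is no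
   subspace, gets the value -oo. *)
Definition Fmin d b (M : 'M[C]_d -> 'M[C]_b) (m : nat) : \bar R :=
  ereal_sup
    [set ereal_sup
      [set ereal_inf
        [set (complex.Re (braket w (D (M (ketbra w w)) *m w)))%:E
        | w in [set w : 'cV[C]_d | w \in H /\ braket w w = 1]]
      | D in [set D : {linear 'M[C]_b -> 'M[C]_d} | decoder H D]]
    | H in [set H : {vspace 'cV[C]_d} | \dim H = m]].

(* Only 1 <= m <= d can be admissible, so that the supremum is a maximum. *)
Definition oneshotQ d b (M : 'M[C]_d -> 'M[C]_b) (eps : R) : \bar R :=
  ereal_sup [set (log2 m%:R)%:E
            | m in [set m : nat | (0 < m)%N /\ ((1 - eps)%:E <= Fmin M m)%E]].

Definition gfun (x : R) : R := - log2 (1 - Num.sqrt (1 - x ^+ 2)).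

Definition delta_objective (eps delta : R) : R :=
  gfun (Num.sqrt (eps / 2) - delta) - 4 * log2 delta.

Definition delta_minimizer (eps delta : R) : Prop :=
  0 < delta < Num.sqrt (eps / 2) /\
  forall delta', 0 < delta' < Num.sqrt (eps / 2) ->
    delta_objective eps delta <= delta_objective eps delta'.

End Capacity.

Section TwoQubitUnitary.
Variable R : realType.
Local Notation C := R[i].

Definition expi (x : R) : C := cos x +i* sin x.

Definition Ualpha (alpha : R * R * R) : 'M[C]_(2 * 2) :=
  let: (ax, ay, az) := alpha in
  let cm : C := (cos ((ax - ay) / 2))%:C in
  let sm : C := - 'i * (sin ((ax - ay) / 2))%:C in
  let cp : C := expi az * (cos ((ax + ay) / 2))%:C in
  let sp : C := - 'i * expi az * (sin ((ax + ay) / 2))%:C in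
  \matrix_(i, j)
    nth 0 (nth [::] [:: [:: cm; 0;  0;  sm];
                        [:: 0;  cp; sp; 0 ];
                        [:: 0;  sp; cp; 0 ];
                        [:: sm; 0;  0;  cm]] i) j.

Definition Uconj (alpha : R * R * R) (phi omega : 'M[C]_2) : 'M[C]_(2 * 2) :=
  Ualpha alpha *m (phi *t omega) *m adjmx (Ualpha alpha).

Definition channelN (alpha : R * R * R) (phi omega : 'M[C]_2) : 'M[C]_2 :=
  ptrace2 (Uconj alpha phi omega).

Definition channelNc (alpha : R * R * R) (phi omega : 'M[C]_2) : 'M[C]_2 :=
  ptrace1 (Uconj alpha phi omega).

Definition rhoBF (alpha : R * R * R) (phi : 'M[C]_2) (Phi : 'M[C]_(2 * 2)) :
    'M[C]_(2 * 2) :=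
  tens_map (@id 'M[C]_2) (channelNc alpha phi) Phi.

Definition alpha_Identity : R * R * R := (0, 0, 0).
Definition alpha_CNOT : R * R * R := (pi / 2, 0, 0).
Definition alpha_SWAP : R * R * R := (pi / 2, pi / 2, pi / 2).
Definition alpha_DCNOT : R * R * R := (pi / 2, pi / 2, 0).

Definition ket0bra0 : 'M[C]_2 := delta_mx 0 0.

End TwoQubitUnitary.

Arguments alpha_Identity {R}.
Arguments alpha_CNOT {R}.
Arguments alpha_SWAP {R}.
Arguments alpha_DCNOT {R}.
Arguments ket0bra0 {R}.

(* Main.v *)
(** For an orthogonal projection P with tr (rho P) = 1 one has
    tr (X ^ 2) >= 1 / tr (P (1 (x) sigma)), where X = S rho S and
    S = (1 (x) sigma) ^ (-1/4): test X against W = S^-1 P S^-1, for which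
    tr (X W) = 1, and bound tr (W ^ 2) by pinching. The choice P = 1 gives
    H_2 <= log2 (dim B) = 1 for every channel. For the Identity and CNOT
    parameters U commutes with 1 (x) X, so the complementary channel preserves
    the expectation of the Pauli operator X, rho is stabilized by G (x) X for a
    suitable Hermitian involution G, and P = (1 + G (x) X) / 2 gives H_2 <= 0.

    For SWAP and DCNOT with phi = |0><0|, N is conjugation by a diagonal unitary
    and its complement is constant, so that rho = (1 / 2) (x) |0><0|. Then
    N^(x)n transmits the whole space perfectly, Q^eps >= n, and the bound holds
    because its correction terms are nonpositive. *)
Require Import Defs.
From HB Require Import structures.
From mathcomp Require Import all_boot all_order all_algebra.
From mathcomp Require Import all_classical all_reals all_analysis.
From mathcomp Require Import complex mxtens.
From mathcomp Require Import ring lra.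

Set Implicit Arguments.
Unset Strict Implicit.
Unset Printing Implicit Defensive.

Import Order.TTheory GRing.Theory Num.Theory.
Local Open Scope ring_scope.

(** * Adjoints, tensor products and conjugation maps *)

Section Adjoint.
Variable R : realType.
Local Notation C := R[i].

Lemma adjmxK m n : cancel (@adjmx R m n) (@adjmx R n m).
Proof. by move=> A; apply/matrixP => i j; rewrite !mxE conjcK. Qed.

Lemma adjmxM m n p (A : 'M[C]_(m, n)) (B : 'M[C]_(n, p)) :
  adjmx (A *m B) = adjmx B *m adjmx A.
Proof. by rewrite /adjmx trmx_mul map_mxM. Qed.

Lemma adjmxD m n (A B : 'M[C]_(m, n)) : adjmx (A + B) = adjmx A + adjmx B.
Proof. by rewrite /adjmx linearD map_mxD. Qed.

Lemma adjmxB m n (A B : 'M[C]_(m, n)) : adjmx (A - B) = adjmx A - adjmx B.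
Proof. by rewrite /adjmx linearB map_mxB. Qed.

Lemma adjmxZ m n (a : C) (A : 'M[C]_(m, n)) :
  adjmx (a *: A) = conjc a *: adjmx A.
Proof. by rewrite /adjmx linearZ map_mxZ. Qed.

Lemma adjmx0 m n : adjmx (0 : 'M[C]_(m, n)) = 0.
Proof. by rewrite /adjmx linear0 map_mx0. Qed.

Lemma adjmx_sum m n (I : Type) (r : seq I) (P : pred I) (F : I -> 'M[C]_(m, n)) :
  adjmx (\sum_(i <- r | P i) F i) = \sum_(i <- r | P i) adjmx (F i).
Proof. exact: (big_morph _ (@adjmxD m n) (@adjmx0 m n)). Qed.

Lemma adjmx1 n : adjmx (1%:M : 'M[C]_n) = 1%:M.
Proof. by rewrite /adjmx trmx1 map_mx1. Qed.

Lemma adjmx_tens m n p q (A : 'M[C]_(m, n)) (B : 'M[C]_(p, q)) :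
  adjmx (A *t B) = adjmx A *t adjmx B.
Proof. by rewrite /adjmx trmx_tens map_mxT. Qed.

Lemma adjmx_ketbra d (v w : 'cV[C]_d) : adjmx (ketbra v w) = ketbra w v.
Proof. by rewrite /ketbra adjmxM adjmxK. Qed.

Lemma adjmx_delta m n (i : 'I_m) (j : 'I_n) :
  adjmx (delta_mx i j : 'M[C]_(m, n)) = delta_mx j i.
Proof. by apply/matrixP => k l; rewrite !mxE andbC; case: (_ && _); rewrite ?conjc0 ?conjc1. Qed.

Lemma unitary_adjmx n (V : 'M[C]_n) : V \is unitarymx -> V *m adjmx V = 1%:M.
Proof.
by move=> /unitarymxP <-; congr (_ *m _); apply/matrixP => i j.
Qed.

Lemma unitary_adjmxl n (V : 'M[C]_n) : V \is unitarymx -> adjmx V *m V = 1%:M.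
Proof. by move=> /unitary_adjmx/mulmx1C. Qed.

Lemma invmx_adj n (V : 'M[C]_n) : V \is unitarymx -> invmx V = adjmx V.
Proof.
move=> hV; rewrite -[LHS]mulmx1 -(unitary_adjmx hV) mulmxA mulVmx ?mul1mx//.
exact: unitarymx_unit.
Qed.

Lemma mxtrace_adj_ge0 m n (A : 'M[C]_(m, n)) : 0 <= \tr (A *m adjmx A).
Proof.
apply: sumr_ge0 => i _; rewrite mxE; apply: sumr_ge0 => j _.
by rewrite !mxE mulcJ_ge0.
Qed.

Lemma mxtrace_sqr_herm_ge0 n (A : 'M[C]_n) : adjmx A = A -> 0 <= \tr (A *m A).
Proof. by move=> hA; rewrite -{2}hA mxtrace_adj_ge0. Qed.

Lemma tens_mxtrace m n (A : 'M[C]_m) (B : 'M[C]_n) :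
  \tr (A *t B) = \tr A * \tr B.
Proof.
by rewrite /mxtrace mulr_sum; apply: eq_bigr => k _; rewrite !mxE.
Qed.

Lemma tensmxDr m n p q (A : 'M[C]_(m, n)) : {morph (@tensmx C m n p q A) : B D / B + D}.
Proof. by move=> B D; apply/matrixP => i j; rewrite !mxE mulrDr. Qed.

Lemma tensmxDl m n p q (B : 'M[C]_(p, q)) :
  {morph ((@tensmx C m n p q)^~ B) : A D / A + D}.
Proof. by move=> A D; apply/matrixP => i j; rewrite !mxE mulrDl. Qed.

Lemma tensmx_sumr m n p q (A : 'M[C]_(m, n)) I (r : seq I) (P : pred I)
    (F : I -> 'M[C]_(p, q)) :
  A *t (\sum_(i <- r | P i) F i) = \sum_(i <- r | P i) (A *t F i).
Proof. by apply: (big_morph (@tensmx C m n p q A)); [exact: tensmxDr | exact: tensmx0]. Qed.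

Lemma tensmx_suml m n p q (B : 'M[C]_(p, q)) I (r : seq I) (P : pred I)
    (F : I -> 'M[C]_(m, n)) :
  (\sum_(i <- r | P i) F i) *t B = \sum_(i <- r | P i) (F i *t B).
Proof. by apply: (big_morph (fun D => @tensmx C m n p q D B)); [exact: tensmxDl | exact: tens0mx]. Qed.

Lemma tensmxZr m n p q (A : 'M[C]_(m, n)) (a : C) (B : 'M[C]_(p, q)) :
  A *t (a *: B) = a *: (A *t B).
Proof. by apply/matrixP => i j; rewrite !mxE mulrCA. Qed.

Lemma tensmxZl m n p q (A : 'M[C]_(m, n)) (a : C) (B : 'M[C]_(p, q)) :
  (a *: A) *t B = a *: (A *t B).
Proof. by apply/matrixP => i j; rewrite !mxE mulrA. Qed.

Lemma tensmx11 m n : (1%:M : 'M[C]_m) *t (1%:M : 'M[C]_n) = 1%:M.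
Proof.
apply/matrixP => i j.
case: (mxtens_indexP i) => i1 i2; case: (mxtens_indexP j) => j1 j2.
rewrite tensmxE !mxE -natrM mulnb.
congr ((nat_of_bool _)%:R); apply/andP/eqP => [[/eqP-> /eqP->]//|].
by move/(can_inj (@mxtens_indexK _ _)) => [-> ->].
Qed.

Lemma tensmx_delta m n p q (i : 'I_m) (j : 'I_n) (k : 'I_p) (l : 'I_q) :
  delta_mx i j *t delta_mx k l =
  delta_mx (mxtens_index (i, k)) (mxtens_index (j, l)) :> 'M[C]_(_, _).
Proof.
apply/matrixP => x y.
case: (mxtens_indexP x) => x1 x2; case: (mxtens_indexP y) => y1 y2.
rewrite tensmxE !mxE -natrM mulnb.
rewrite !(inj_eq (can_inj (@mxtens_indexK _ _))) !xpair_eqE.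
by congr ((nat_of_bool _)%:R); rewrite andbACA.
Qed.

Lemma sum_mxtens_index m n (V : nmodType) (F : 'I_(m * n) -> V) :
  \sum_i F i = \sum_(i < m) \sum_(j < n) F (mxtens_index (i, j)).
Proof.
rewrite pair_big /= (reindex (@mxtens_index m n)) /=; last first.
  by exists (@mxtens_unindex m n) => x _; rewrite ?mxtens_indexK ?mxtens_unindexK.
by apply: eq_bigr => -[].
Qed.

Lemma tens_expand m n (X : 'M[C]_(m * n)) :
  X = \sum_(i < m) \sum_(j < m) \sum_(k < n) \sum_(l < n)
    X (mxtens_index (i, k)) (mxtens_index (j, l))
      *: (delta_mx i j *t delta_mx k l).
Proof.
rewrite [LHS]matrix_sum_delta sum_mxtens_index; apply: eq_bigr => i _.
rewrite [RHS]exchange_big /=; apply: eq_bigr => k _.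
rewrite sum_mxtens_index; apply: eq_bigr => j _.
by apply: eq_bigr => l _; rewrite tensmx_delta.
Qed.

(** For arbitrary functions [f] and [g]: both are evaluated at matrix units only, and [X] enters
    through its coefficients. *)
Lemma tens_map_linear a b c d (f : 'M[C]_a -> 'M[C]_b) (g : 'M[C]_c -> 'M[C]_d) :
  linear (tens_map f g).
Proof.
move=> t X Y; rewrite /tens_map.
do 4 (rewrite scaler_sumr -big_split; apply: eq_bigr => ? _ /=).
by rewrite !mxE scalerA scalerDl.
Qed.

HB.instance Definition _ a b c d (f : 'M[C]_a -> 'M[C]_b) (g : 'M[C]_c -> 'M[C]_d) :=
  GRing.isLinear.Build C _ _ _ (tens_map f g) (tens_map_linear f g).

Lemma tens_map_tens a b c d (f : {linear 'M[C]_a -> 'M[C]_b})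
    (g : {linear 'M[C]_c -> 'M[C]_d}) A B :
  tens_map f g (A *t B) = f A *t g B.
Proof.
rewrite [in RHS](matrix_sum_delta A) [in RHS](matrix_sum_delta B).
rewrite linear_sum tensmx_suml; apply: eq_bigr => i _.
rewrite linear_sum tensmx_suml; apply: eq_bigr => j _.
rewrite linear_sum tensmx_sumr; apply: eq_bigr => k _.
rewrite linear_sum tensmx_sumr; apply: eq_bigr => l _.
by rewrite tensmxE !linearZ /= tensmxZl tensmxZr scalerA.
Qed.

(** The completely positive map with the single Kraus operator [V]. *)
Definition mxconj m n (V : 'M[C]_(m, n)) (X : 'M[C]_n) : 'M[C]_m :=
  V *m X *m adjmx V.

Fact mxconj_linear m n (V : 'M[C]_(m, n)) : linear (mxconj V).
Proof.
by move=> a X Y; rewrite /mxconj mulmxDr mulmxDl -scalemxAr -scalemxAl.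
Qed.

HB.instance Definition _ m n (V : 'M[C]_(m, n)) :=
  GRing.isLinear.Build C _ _ _ (mxconj V) (mxconj_linear V).

Lemma mxconj_tens m n p q (V : 'M[C]_(m, n)) (W : 'M[C]_(p, q)) A B :
  mxconj (V *t W) (A *t B) = mxconj V A *t mxconj W B.
Proof. by rewrite /mxconj adjmx_tens !tensmx_mul. Qed.

Lemma tens_map_conj m n p q (V : 'M[C]_(m, n)) (W : 'M[C]_(p, q)) X :
  tens_map (mxconj V) (mxconj W) X = mxconj (V *t W) X.
Proof.
rewrite {2}(tens_expand X) /tens_map.
do 4 (rewrite linear_sum; apply: eq_bigr => ? _).
by rewrite linearZ /= mxconj_tens.
Qed.

Lemma psd_mxconj m n (V : 'M[C]_(m, n)) X : psd X -> psd (mxconj V X).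
Proof.
move=> hX v; have := hX (adjmx V *m v).
by rewrite /braket /mxconj adjmxM adjmxK !mulmxA.
Qed.

Lemma mxconj1 m (X : 'M[C]_m) : mxconj 1%:M X = X.
Proof. by rewrite /mxconj adjmx1 mul1mx mulmx1. Qed.

(** The identity map is conjugation by 1, so the extended map is conjugation by 1 (x) V, which
    preserves positivity. *)
Lemma completely_positive_mxconj m n (V : 'M[C]_(m, n)) :
  completely_positive (mxconj V).
Proof.
move=> k X hX; rewrite (_ : @id 'M[C]_k = mxconj 1%:M) ?tens_map_conj.
  exact: psd_mxconj.
by apply/funext => Y; rewrite mxconj1.
Qed.

Lemma tens_pow_mxconj m n (V : 'M[C]_(m, n)) k X :
  tens_pow (mxconj V) k.+1 X = mxconj (V ^t k.+1) X.
Proof.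
rewrite /tens_pow; elim: k X => [//|k IHk] X.
rewrite -[LHS]/(tens_map (mxconj V) (@tens_pow_rec R _ _ (mxconj V) k) X).
rewrite (_ : @tens_pow_rec R _ _ (mxconj V) k = mxconj (V ^t k.+1)).
  exact: tens_map_conj.
exact/funext.
Qed.

Lemma ntensmx_unitary n (V : 'M[C]_n) k :
  adjmx V *m V = 1%:M -> adjmx (V ^t k.+1) *m (V ^t k.+1) = 1%:M.
Proof.
move=> hV; elim: k => [//|k IHk].
by rewrite ntensmxSS adjmx_tens tensmx_mul hV (IHk : adjmx _ *m _ = _) tensmx11.
Qed.

End Adjoint.

(** * Real powers of positive definite matrices *)

Section Powers.
Variable R : realType.
Local Notation C := R[i].

Lemma braket_mulmx_delta d (A : 'M[C]_d) i j :
  braket (delta_mx i 0) (A *m delta_mx j 0) = A i j.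
Proof. by rewrite /braket adjmx_delta -colE -rowE !mxE. Qed.

Lemma posdef_psd d (A : 'M[C]_d) : posdef A -> psd A.
Proof.
move=> hA v; have [->|v0] := eqVneq v 0; last exact/ltW/hA.
by rewrite /braket mulmx0 mulmx0 mxE.
Qed.

(* Polarization: the form is real at e_i + e_j and at e_i + i e_j. *)
Lemma psd_adjmx d (A : 'M[C]_d) : psd A -> adjmx A = A.
Proof.
move=> hA; pose B (u w : 'cV[C]_d) := braket u (A *m w).
have BD a u w : B (u + a *: w) (u + a *: w) =
    B u u + conjc a * a * B w w + (a * B u w + conjc a * B w u).
  rewrite /B /braket adjmxD adjmxZ !(mulmxDr, mulmxDl) -!scalemxAr -!scalemxAl.
  rewrite !mxE; ring.
have real u : complex.Im (B u u) = 0 by apply/ger0_Im/hA.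
have key a u w : complex.Im (a * B u w + conjc a * B w u) = 0.
  have := real (u + a *: w); rewrite BD; move: (a * B u w + _) => z.
  have := real u; have := real w.
  have : complex.Im (conjc a * a) = 0 by case: a => a b /=; ring.
  case: (conjc a * a) => p q; case: (B w w) => r s; case: (B u u) => t t'.
  by case: z => x y /= -> -> ->; rewrite !mulr0 !mul0r !add0r.
apply/matrixP => i j; rewrite !mxE -!braket_mulmx_delta.
have := key 1 (delta_mx i 0) (delta_mx j 0).
have := key (Complex 0 1) (delta_mx i 0) (delta_mx j 0).
rewrite /B; case: (braket _ _) => a b; case: (braket _ _) => c d' /= h1 h2.
apply/eqP; rewrite eq_complex /=; apply/andP; split; apply/eqP; lra.
Qed.

(** The real witness lets a complex eigenvalue be replaced by [r%:C], which matches [mxpowR], where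
    only real parts are read. *)
Definition posdiag d (x : 'rV[C]_d) : Prop :=
  forall i, exists2 r : R, 0 < r & x 0 i = r%:C%C.

Lemma psd_normal d (A : 'M[C]_d) : psd A -> A \is normalmx.
Proof.
move=> /psd_adjmx hA; apply/normalmxP.
suff -> : (map_mx Num.conj A^T) = A by [].
by rewrite -[RHS]hA; apply/matrixP => i j; rewrite !mxE.
Qed.

Lemma spectral_decomp d (A : 'M[C]_d) : psd A ->
  A = invmx (spectralmx A) *m diag_mx (spectral_diag A) *m spectralmx A.
Proof. by move=> /psd_normal /orthomx_spectralP. Qed.

Lemma mulmx_adj_spectral d (A : 'M[C]_d) : psd A ->
  A *m adjmx (spectralmx A) = adjmx (spectralmx A) *m diag_mx (spectral_diag A).
Proof.
move=> hA; have := spectral_decomp hA; have := spectral_unitarymx A.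
move: (spectralmx A) (spectral_diag A) => P D uP ->.
by rewrite invmx_adj // -!mulmxA unitary_adjmx // mulmx1.
Qed.

Lemma posdef_spectral_diag d (A : 'M[C]_d) : posdef A -> posdiag (spectral_diag A).
Proof.
move=> hA i; have := mulmx_adj_spectral (posdef_psd hA).
have := spectral_unitarymx A.
move: (spectralmx A) (spectral_diag A) => P D uP AP.
(* The i-th eigenvector of A; the quadratic form of A at [v] is the eigenvalue [D 0 i]. *)
pose v := adjmx P *m delta_mx i 0 : 'cV[C]_d.
have Pv : P *m v = delta_mx i 0 by rewrite mulmxA unitary_adjmx // mul1mx.
have v0 : v != 0.
  apply/eqP => v0; move/matrixP/(_ i 0): Pv.
  by rewrite v0 mulmx0 !mxE !eqxx => /esym/eqP; rewrite oner_eq0.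
have Av : A *m v = adjmx P *m (diag_mx D *m delta_mx i 0).
  by rewrite mulmxA AP mulmxA.
have := hA v v0; rewrite Av /braket mulmxA -adjmxM Pv.
rewrite -/(braket _ _) braket_mulmx_delta mxE eqxx mulr1n.
case: (D 0 i) => a b; rewrite ltcE /= => /andP[/eqP -> a0].
by exists a.
Qed.

Lemma adjmx_diag_real d (x : 'rV[R]_d) :
  adjmx (diag_mx (map_mx (real_complex R) x)) = diag_mx (map_mx (real_complex R) x).
Proof.
apply/matrixP => i j; rewrite !mxE eq_sym.
by have [->|_] := eqVneq i j; rewrite ?mulr1n ?conjc_real // !mulr0n conjc0.
Qed.

Lemma adjmx_mxpowR d (A : 'M[C]_d) s : adjmx (mxpowR A s) = mxpowR A s.
Proof.
rewrite /mxpowR invmx_adj ?spectral_unitarymx //.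
move: (spectralmx A) (spectral_diag A) => P D.
have -> : map_mx (fun z : C => (powR (complex.Re z) s)%:C%C) D =
    map_mx (real_complex R) (map_mx (fun z => powR (complex.Re z) s) D).
  by apply/rowP => i; rewrite !mxE.
by rewrite !adjmxM adjmxK adjmx_diag_real mulmxA.
Qed.

Lemma mxpowRD d (A : 'M[C]_d) s t : posdef A ->
  mxpowR A s *m mxpowR A t = mxpowR A (s + t).
Proof.
move=> hA; rewrite /mxpowR; have := posdef_spectral_diag hA; have := spectral_unit A.
move: (spectralmx A) (spectral_diag A) => P D uP hD.
have := mulmxV uP; move: (invmx P) => Q PQ.
set Ds := map_mx _ D; set Dt := map_mx _ D; set Dst := map_mx _ D.
suff -> : Dst = \row_j (Ds 0 j * Dt 0 j).
  by rewrite -mulmx_diag !mulmxA -(mulmxA _ P Q) PQ mulmx1.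
apply/rowP => i; rewrite !mxE; have [r r0 ->] := hD i.
(* When the exponents add up to 0, additivity requires a nonzero base; positivity of [r] supplies
   this. *)
by rewrite /= -rmorphM /= powRD // (gt_eqF r0) implybT.
Qed.

Lemma mxpowR0 d (A : 'M[C]_d) : mxpowR A 0 = 1%:M.
Proof.
rewrite /mxpowR (_ : map_mx _ _ = const_mx 1); last first.
  by apply/rowP => i; rewrite !mxE powRr0.
by rewrite diag_const_mx mulmx1 mulVmx // spectral_unit.
Qed.

Lemma mxpowR1 d (A : 'M[C]_d) : posdef A -> mxpowR A 1 = A.
Proof.
move=> hA; have := spectral_decomp (posdef_psd hA); rewrite /mxpowR.
have := posdef_spectral_diag hA.
move: (spectralmx A) (spectral_diag A) => P D hD AE; rewrite [RHS]AE.
suff -> : map_mx (fun z : C => (powR (complex.Re z) 1)%:C%C) D = D by [].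
apply/rowP => i; rewrite !mxE.
by have [r r0 ->] := hD i; rewrite /= powRr1 // ltW.
Qed.

(** The form is the squared norm of [M *m v], and the left inverse [N] makes [M] injective. *)
Lemma posdef_mulmx_adj d (M N : 'M[C]_d) : N *m M = 1%:M -> posdef (adjmx M *m M).
Proof.
move=> NM v v0; rewrite /braket -mulmxA mulmxA -adjmxM.
have : M *m v != 0.
  by apply: contraNneq v0 => h; rewrite -[v]mul1mx -NM -mulmxA h mulmx0.
move: (M *m v) => w; case/cV0Pn => i wi.
have sum_w : (adjmx w *m w) 0 0 = \sum_j (conjc (w j 0) * w j 0).
  by rewrite mxE; apply: eq_bigr => j _; rewrite !mxE.
have ge0 j : 0 <= conjc (w j 0) * w j 0 by rewrite mulrC mulcJ_ge0.
rewrite sum_w lt0r sumr_ge0 // andbT psumr_eq0 //.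
apply/allPn; exists i; rewrite ?mem_index_enum //=.
by rewrite mulf_neq0 // conjc_eq0.
Qed.

(** With M the square root of sigma, 1 (x) sigma is the product of the adjoint of 1 (x) M with 1 (x)
    M, and 1 (x) sigma^(-1/2) inverts the latter. *)
Lemma posdef_tens1 b f (sigma : 'M[C]_f) : posdef sigma ->
  posdef ((1%:M : 'M[C]_b) *t sigma).
Proof.
move=> hs; set M := mxpowR sigma 2^-1.
have sE : sigma = adjmx M *m M.
  by rewrite adjmx_mxpowR mxpowRD // (_ : 2^-1 + 2^-1 = 1) ?mxpowR1 //; field.
rewrite {1}sE -{1}[1%:M]mul1mx -{1}adjmx1 -tensmx_mul -adjmx_tens.
apply: (@posdef_mulmx_adj _ _ (1%:M *t mxpowR sigma (- 2^-1))).
by rewrite tensmx_mul mul1mx mxpowRD // addNr mxpowR0 tensmx11.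
Qed.

(* P A = D P reads P_ij (A_j - D_i) = 0 entrywise, so the same holds after
   applying a function to the eigenvalues. *)
Lemma mxpowR_diag d (x : 'rV[R]_d) s : (forall i, 0 < x 0 i) ->
  mxpowR (diag_mx (map_mx (real_complex R) x)) s =
  diag_mx (map_mx (fun r => (r `^ s)%:C%C) x).
Proof.
set A := diag_mx _ => x0.
have hA : A \is normalmx.
  by apply/normalmxP; rewrite (adjmx_diag_real x : map_mx Num.conj A^T = A).
have /orthomx_spectralP := hA; rewrite /mxpowR; have := spectral_unit A.
move: (spectralmx A) (spectral_diag A) => P D uP AE.
have PB B : B = invmx P *m diag_mx D *m P -> P *m B = diag_mx D *m P.
  by move=> ->; rewrite !mulmxA mulmxV // mul1mx.
have PA := PB A AE.
rewrite -mulmxA (_ : _ *m P = P *m diag_mx (map_mx (fun r => (r `^ s)%:C%C) x)).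
  by rewrite mulKmx.
apply/matrixP => i j; rewrite mul_diag_mx mul_mx_diag !mxE.
move/matrixP/(_ i j): PA; rewrite mul_diag_mx mul_mx_diag !mxE.
have [->|Pij] := eqVneq (P i j) 0; first by rewrite !mul0r !mulr0.
by rewrite mulrC => /(mulIf Pij) <-; rewrite mulrC.
Qed.

End Powers.

(** * Upper bounds on the conditional entropy from a projection *)

Section EntropyBound.
Variable R : realType.
Local Notation C := R[i].

Lemma mxtrace_pinching_le n (P M : 'M[C]_n) :
  adjmx P = P -> adjmx M = M -> P *m P = P ->
  \tr (P *m M *m P *m M) <= \tr (P *m (M *m M)).
Proof.
move=> hP hM PP; rewrite -subr_ge0 -raddfB /=.
have := mxtrace_adj_ge0 (P *m M *m (1%:M - P)); rewrite !adjmxM hP hM.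
have hQ : adjmx (1%:M - P) = 1%:M - P.
  by rewrite adjmxB adjmx1 hP.
have QQ : (1%:M - P) *m (1%:M - P) = 1%:M - P.
  by rewrite mulmxBl mul1mx mulmxBr mulmx1 PP subrr subr0.
rewrite hQ -!mulmxA (mulmxA (1%:M - P) (1%:M - P)) QQ !mulmxA mxtrace_mulC.
rewrite -!mulmxA (mulmxA P P) PP.
by rewrite mulmxBl mul1mx !mulmxBr !mulmxA.
Qed.

(* Expand tr (X - W / c) ^ 2 >= 0. *)
Lemma mxtrace_sqr_ge_dual n (X W : 'M[C]_n) (c : R) :
  adjmx X = X -> adjmx W = W -> 0 < c ->
  \tr (X *m W) = 1 -> \tr (W *m W) <= c%:C%C -> (c^-1)%:C%C <= \tr (X *m X).
Proof.
move=> hX hW c0 XW WW; set k := (c^-1)%:C%C.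
have WX : \tr (W *m X) = 1 by rewrite mxtrace_mulC.
have k0 : 0 <= k by rewrite ler0c invr_ge0 ltW.
have trB (A B : 'M[C]_n) : \tr (A - B) = \tr A - \tr B by exact: raddfB.
have hY : adjmx (X - k *: W) = X - k *: W.
  by rewrite adjmxB adjmxZ hX hW conjc_real.
have trBB (Z : 'M[C]_n) : \tr ((X - Z) *m (X - Z)) =
    \tr (X *m X) - \tr (X *m Z) - (\tr (Z *m X) - \tr (Z *m Z)).
  by rewrite mulmxBl mulmxBr mulmxBr !trB.
have trZr a (A B : 'M[C]_n) : \tr (A *m (a *: B)) = a * \tr (A *m B).
  by rewrite -scalemxAr mxtraceZ.
have trZl a (A B : 'M[C]_n) : \tr (a *: A *m B) = a * \tr (A *m B).
  by rewrite -scalemxAl mxtraceZ.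
have := mxtrace_sqr_herm_ge0 hY.
rewrite trBB (trZr k X W) (trZl k W X) (trZl k W) (trZr k W W).
rewrite XW WX mulr1 mulrA => Y0.
have k2 : k * k * \tr (W *m W) <= k.
  apply: le_trans (ler_wpM2l (mulr_ge0 k0 k0) WW) _.
  by rewrite /k -!rmorphM /= -mulrA mulVf ?mulr1 // gt_eqF.
rewrite -subr_ge0; apply: le_trans Y0 _.
by rewrite gerBl subr_ge0.
Qed.

(** Here [S] and [T] stand for A^(-1/4) and A^(1/4), so that the last hypothesis reads tr (P A) = c.
    The dual witness is W = T P T: cyclicity gives tr (X W) = tr (rho P) = 1, and pinching with M =
    T^2 bounds tr (W^2) by c. *)
Lemma mxtrace_sqr_ge n (S T rho P : 'M[C]_n) (c : R) :
  adjmx S = S -> adjmx T = T -> adjmx rho = rho -> adjmx P = P ->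
  S *m T = 1%:M -> P *m P = P -> \tr (rho *m P) = 1 -> 0 < c ->
  \tr (P *m ((T *m T) *m (T *m T))) = c%:C%C ->
  (c^-1)%:C%C <= \tr ((S *m rho *m S) *m (S *m rho *m S)).
Proof.
move=> hS hT hrho hP ST PP trP c0 trA; have TS := mulmx1C ST.
apply: (@mxtrace_sqr_ge_dual _ _ (T *m P *m T)) => //.
- by rewrite !adjmxM hS hrho mulmxA.
- by rewrite !adjmxM hT hP mulmxA.
- rewrite mxtrace_mulC -!mulmxA (mulmxA T S) TS mul1mx mxtrace_mulC.
  by rewrite -!mulmxA ST mulmx1 mxtrace_mulC.
have hM : adjmx (T *m T) = T *m T by rewrite adjmxM hT.
rewrite -trA; apply: le_trans (mxtrace_pinching_le hP hM PP).
by rewrite -!mulmxA mxtrace_mulC -!mulmxA.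
Qed.

(** Since [c] is the same for all sigma, the trace bound for a single sigma controls the whole
    supremum. *)
Lemma condH2_le b f (rho P : 'M[C]_(b * f)) (c : R) :
  adjmx rho = rho -> adjmx P = P -> P *m P = P -> \tr (rho *m P) = 1 -> 0 < c ->
  (forall sigma, \tr sigma = 1 -> \tr (P *m (1%:M *t sigma)) = c%:C%C) ->
  (condH2 rho <= (log2 c)%:E)%E.
Proof.
move=> hrho hP PP trP c0 trPs; apply: ge_ereal_sup => _ [sigma [hs trs] <-] /=.
rewrite lee_fin.
have hA := @posdef_tens1 R b f sigma hs; move: (trPs _ trs) hA.
move: (1%:M *t sigma : 'M[C]_(b * f)) => A trA hA.
have h1 : mxpowR A (- 4^-1) *m mxpowR A (4^-1) = 1%:M.
  by rewrite mxpowRD // addNr mxpowR0.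
have h2 : (mxpowR A (4^-1) *m mxpowR A (4^-1)) *m
    (mxpowR A (4^-1) *m mxpowR A (4^-1)) = A.
  rewrite !mxpowRD // (_ : 4^-1 + 4^-1 + (4^-1 + 4^-1) = 1) ?mxpowR1 //; by field.
move: h1 h2 (adjmx_mxpowR A (- 4^-1)) (adjmx_mxpowR A 4^-1).
move: (mxpowR A _) (mxpowR A _) => S T ST TT hS hT.
rewrite -TT in trA.
have := mxtrace_sqr_ge hS hT hrho hP ST PP trP c0 trA.
rewrite expr2; case: (\tr _) => x y; rewrite lecE /= => /andP[_ cx].
rewrite /log2 -mulNr ler_pM2r ?invr_gt0 ?ln_gt0 ?ltr1n //.
(* The lower bound [c^-1] also shows that the trace is positive, as the monotonicity of [ln]
   requires. *)
have cV : 0 < c^-1 by rewrite invr_gt0.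
rewrite lerNl -lnV ?posrE // ler_ln ?posrE //.
exact: lt_le_trans cx.
Qed.

End EntropyBound.

(** * One-shot capacity of unitary channels and the minimizer of the correction terms *)

Section Capacity.
Import numFieldNormedType.Exports.
Local Open Scope classical_set_scope.
Variable R : realType.
Local Notation C := R[i].

(** Take the whole space as the code and the inverse conjugation as the decoder: every unit vector
    is recovered exactly. *)
Lemma Fmin_mxconj_unitary d (V : 'M[C]_d) :
  adjmx V *m V = 1%:M -> (1%:E <= Fmin (mxconj V) d)%E.
Proof.
move=> hV; apply: le_ereal_sup_tmp.
exists (ereal_sup [set ereal_inf
        [set (complex.Re (braket w (D (mxconj V (ketbra w w)) *m w)))%:E
        | w in [set w : 'cV[C]_d | w \in fullv /\ braket w w = 1]]
      | D in [set D : {linear 'M[C]_d -> 'M[C]_d} | decoder fullv D]]).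
  by exists fullv => //=; rewrite dimvf dim_matrix mulr1.
apply: le_ereal_sup_tmp.
eexists; first exists (mxconj (adjmx V)) => //=.
  split; first exact: completely_positive_mxconj.
  - move=> X; rewrite /mxconj mxtrace_mulC mulmxA.
    by rewrite adjmxK (mulmx1C hV) mul1mx.
  - move=> X; split => [v|v hv]; first exact: memvf.
    (* The orthogonal complement of the full space is 0, as testing against basis vectors shows. *)
    suff -> : v = 0 by rewrite mulmx0.
    apply/matrixP => i j; have := hv (delta_mx i 0) (memvf _).
    by rewrite /braket adjmx_delta -rowE !mxE (ord1 j).
apply: le_ereal_inf_tmp => _ [w [_ ww] <-] /=; rewrite lee_fin.
have -> : mxconj (adjmx V) (mxconj V (ketbra w w)) = ketbra w w.
  by rewrite /mxconj adjmxK !mulmxA hV mul1mx -mulmxA hV mulmx1.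
rewrite /ketbra -mulmxA (_ : adjmx w *m w = 1%:M) ?mulmx1 ?ww //.
by apply/matrixP => i j; rewrite !ord1 -/(braket w w) [LHS]ww mxE.
Qed.

Lemma oneshotQ_mxconj_unitary d (V : 'M[C]_d) (eps : R) :
  (0 < d)%N -> 0 <= eps -> adjmx V *m V = 1%:M ->
  ((log2 d%:R)%:E <= oneshotQ (mxconj V) eps)%E.
Proof.
move=> d0 eps0 hV; apply: ereal_sup_ubound; exists d => //=; split=> //.
by apply: le_trans (Fmin_mxconj_unitary hV); rewrite lee_fin gerBl.
Qed.

(** The tensor power is again conjugation by an isometric square matrix, now in dimension d^(n+1),
    whose logarithm is (n+1) log2 d. *)
Lemma oneshotQ_tens_pow_unitary d (V : 'M[C]_d) (eps : R) n :
  (0 < d)%N -> 0 <= eps -> adjmx V *m V = 1%:M ->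
  ((n.+1%:R * log2 d%:R)%:E <= oneshotQ (tens_pow (mxconj V) n.+1) eps)%E.
Proof.
move=> d0 eps0 hV; have -> : tens_pow (mxconj V) n.+1 = mxconj (V ^t n.+1).
  exact/funext/tens_pow_mxconj.
have -> : n.+1%:R * log2 d%:R = log2 (d ^ n.+1)%:R :> R.
  by rewrite /log2 natrX lnXn ?ltr0n // mulrA mulr_natl.
apply: oneshotQ_mxconj_unitary => //; first by rewrite expn_gt0 d0.
exact: ntensmx_unitary.
Qed.

Lemma ln2_gt0 : 0 < ln 2 :> R.
Proof. by rewrite ln_gt0 // ltr1n. Qed.

Lemma log2_le0 (x : R) : x <= 1 -> log2 x <= 0.
Proof. by move=> x1; rewrite /log2 ler_pdivrMr ?ln2_gt0 // mul0r ln_le0. Qed.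

(** For |x| > 1 the default values matter: [Num.sqrt] is 0 at negative arguments. In every case the
    argument of [log2] is at most 1. *)
Lemma gfun_ge0 (x : R) : 0 <= gfun x.
Proof. by rewrite /gfun oppr_ge0 log2_le0 // gerBl sqrtr_ge0. Qed.

Lemma log2_le_of_expR (x M : R) : 0 < x -> x <= expR (M * ln 2) -> log2 x <= M.
Proof.
by move=> x0 xM; rewrite /log2 ler_pdivrMr ?ln2_gt0 // -ler_expR lnK.
Qed.

(** Quantifies the divergence of g at 0: 1 - x <= sqrt (1 - x^2) on (0, 1), hence 1 - sqrt (1 - x^2)
    <= x <= 2^(-M). *)
Lemma gfun_ge (x M : R) : 0 < x < 1 -> x <= expR (- M * ln 2) -> M <= gfun x.
Proof.
move=> /andP[x0 x1] xM; rewrite /gfun lerNr.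
have h1 : 1 - x <= Num.sqrt (1 - x ^+ 2).
  have -> : 1 - x = Num.sqrt ((1 - x) ^+ 2).
    by rewrite sqrtr_sqr ger0_norm // subr_ge0 ltW.
  by rewrite ler_sqrt; nra.
have h2 : Num.sqrt (1 - x ^+ 2) < 1.
  rewrite -[ltRHS]sqrtr1 ltr_sqrt //; nra.
by apply: log2_le_of_expR; [rewrite subr_gt0|apply: le_trans xM; lra].
Qed.

Lemma delta_objective_continuous (eps delta : R) :
  0 < delta < Num.sqrt (eps / 2) ->
  {for delta, continuous (delta_objective eps)}.
Proof.
move=> /andP[d0 ds]; rewrite /delta_objective /gfun /log2.
have c1 : (fun y : R => Num.sqrt (eps / 2) - y) @ delta -->
    Num.sqrt (eps / 2) - delta.
  by apply: cvgB; [exact: cvg_cst|exact: cvg_id].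
(* The logarithm inside g is continuous here because its argument is positive. *)
have hx : 0 < 1 - Num.sqrt (1 - (Num.sqrt (eps / 2) - delta) ^+ 2).
  rewrite subr_gt0 -[ltRHS]sqrtr1 ltr_sqrt // gtrBl.
  by rewrite exprn_gt0 // subr_gt0.
apply: cvgB.
  apply: cvgN; apply: cvgM; last exact: cvg_cst.
  apply: (@cvg_comp _ _ _ _ (@ln R)); last exact: continuous_ln.
  apply: cvgB; first exact: cvg_cst.
  apply: (@cvg_comp _ _ _ _ (@Num.sqrt R)); last exact: sqrt_continuous.
  apply: cvgB; first exact: cvg_cst.
  rewrite [in X in _ --> X]expr2; under eq_fun do rewrite expr2.
  exact: cvgM.
apply: cvgM; first exact: cvg_cst.
by apply: cvgM; [exact: continuous_ln|exact: cvg_cst].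
Qed.

(** The objective diverges at both ends of the open interval, through -4 log2 delta at 0 and through
    g at s. A compact subinterval outside which it is at least its value at s / 2 therefore contains
    a global minimizer. *)
Lemma delta_minimizer_exists (eps : R) :
  0 < eps <= 2 -> exists delta, delta_minimizer eps delta.
Proof.
move=> /andP[e0 e2]; rewrite /delta_minimizer.
set s := Num.sqrt (eps / 2); have s0 : 0 < s by rewrite sqrtr_gt0; lra.
have s1 : s <= 1 by rewrite -[leRHS]sqrtr1 ler_sqrt //; lra.
pose h := delta_objective eps; pose M := h (s / 2).
(* r1 = 2^(-M/4) and r2 = 2^(-M): y < r1 forces -4 log2 y >= M, and s - y < r2 forces g(s - y) >=
   M. *)
pose r1 := expR (- (M / 4) * ln 2) : R; pose r2 := expR (- M * ln 2) : R.
have r10 : 0 < r1 := expR_gt0 _; have r20 : 0 < r2 := expR_gt0 _.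
(* Capping by s / 2 keeps s / 2 inside [a, b], so the minimum over [a, b] is at most M. *)
pose a := Num.min r1 (s / 2); pose b := s - Num.min r2 (s / 2).
have a0 : 0 < a by rewrite lt_min r10; lra.
have as2 : a <= s / 2 by rewrite ge_min lexx orbT.
have bs : b < s by rewrite ltrBlDr ltrDl lt_min r20; lra.
have sb : s / 2 <= b.
  have : Num.min r2 (s / 2) <= s / 2 by rewrite ge_min lexx orbT.
  by rewrite /b; lra.
have ab : a <= b by exact: le_trans sb.
have hc : {within `[a, b], continuous h}.
  apply: continuous_in_subspaceT => x; rewrite inE /= in_itv /= => /andP[ax xb].
  by apply: delta_objective_continuous; rewrite -/s; apply/andP; split; lra.
have [c] := EVT_min ab hc; rewrite in_itv /= => /andP[ac cb] cmin.
have cM : h c <= M by apply: cmin; rewrite in_itv /= as2.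
exists c; split; first by apply/andP; split; lra.
move=> y /andP[y0 ys]; rewrite -/(h c) -/(h y).
have [ya|ay] := ltP y a.
  apply: le_trans cM _; rewrite /h /delta_objective.
  have := gfun_ge0 (s - y); rewrite -/s.
  have : log2 y <= - (M / 4).
    by apply: log2_le_of_expR => //; apply: ltW; apply: lt_le_trans ya _; rewrite ge_min lexx.
  lra.
have [yb|yb] := leP y b; first by apply: cmin; rewrite in_itv /= ay.
apply: le_trans cM _; rewrite /h /delta_objective -/s.
have : log2 y <= 0 by apply: log2_le0; lra.
have : M <= gfun (s - y).
  apply: gfun_ge; first by apply/andP; split; lra.
  have : Num.min r2 (s / 2) <= r2 by rewrite ge_min lexx.
  by move: yb; rewrite /b -/r2; lra.
lra.
Qed.

(** From eps <= 2 one gets delta < sqrt (eps / 2) <= 1, so all three subtracted terms are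
    nonnegative and the left side is at most 1. *)
Lemma capacity_bound_of_rate1 (eps delta : R) n (Q : \bar R) :
  0 < eps <= 2 -> 0 < delta < Num.sqrt (eps / 2) -> (0 < n)%N ->
  (n%:R%:E <= Q)%E ->
  ((1 - n%:R^-1 * gfun (Num.sqrt (eps / 2) - delta)
    - 4 / n%:R * log2 delta^-1 - 2 / n%:R)%:E <= (n%:R^-1)%:E * Q)%E.
Proof.
move=> /andP[e0 e2] /andP[d0 ds] n0 nQ.
have n0R : 0 < n%:R :> R by rewrite ltr0n.
have s1 : Num.sqrt (eps / 2) <= 1 by rewrite -[leRHS]sqrtr1 ler_sqrt //; lra.
apply: (@le_trans _ _ ((n%:R^-1)%:E * n%:R%:E)%E); last first.
  by rewrite lee_pmul2l // lte_fin invr_gt0.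
rewrite -EFinM lee_fin mulVf ?gt_eqF //.
have nV : 0 < n%:R^-1 :> R by rewrite invr_gt0.
have g0 := mulr_ge0 (ltW nV) (gfun_ge0 (Num.sqrt (eps / 2) - delta)).
have l0 : 0 <= log2 delta^-1.
  by rewrite /log2 lnV ?posrE // mulNr oppr_ge0 log2_le0; lra.
have := mulr_ge0 (ltW nV) l0; move: g0 nV.
rewrite -!mulrA; lra.
Qed.

End Capacity.

(** * Maximally entangled states with a channel applied to one half *)

Section MaximallyEntangled.
Variable R : realType.
Local Notation C := R[i].

Lemma mxtrace_ketbra_mul d (v w : 'cV[C]_d) (G : 'M[C]_d) :
  \tr (ketbra v w *m G) = braket w (G *m v).
Proof.
by rewrite /ketbra /braket -mulmxA mxtrace_mulC /mxtrace big_ord1 mulmxA.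
Qed.

Lemma braket_col d (V G : 'M[C]_d) i j :
  braket (col i V) (G *m col j V) = (adjmx V *m G *m V) i j.
Proof.
by rewrite -braket_mulmx_delta /braket !colE adjmxM -!mulmxA.
Qed.

Lemma sum_ketbra_col d (V : 'M[C]_d) :
  \sum_i ketbra (col i V) (col i V) = V *m adjmx V.
Proof.
apply/matrixP => i j; rewrite summxE !mxE; apply: eq_bigr => k _.
by rewrite !mxE big_ord1 !mxE.
Qed.

Variables (d : nat) (V W : 'M[C]_d).
Hypotheses (hV : V \is unitarymx) (hW : W \is unitarymx).

(** The state (id (x) f)(Phi) written out in the bases of Phi; [f = id] gives Phi itself. *)
Definition entangled_output e (f : 'M[C]_d -> 'M[C]_e) : 'M[C]_(d * e) :=
  d%:R^-1 *: \sum_(i < d) \sum_(j < d)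
    (ketbra (col i V) (col j V) *t f (ketbra (col i W) (col j W))).

Lemma tens_map_entangled e (f : {linear 'M[C]_d -> 'M[C]_e}) :
  tens_map (@id 'M[C]_d) f (entangled_output id) = entangled_output f.
Proof.
rewrite /entangled_output linearZ /=; congr (_ *: _).
rewrite linear_sum; apply: eq_bigr => i _.
rewrite linear_sum; apply: eq_bigr => j _.
exact: (@tens_map_tens R d d d e idfun f).
Qed.

Lemma adjmx_entangled_output e (f : 'M[C]_d -> 'M[C]_e) :
  (forall X, adjmx (f X) = f (adjmx X)) ->
  adjmx (entangled_output f) = entangled_output f.
Proof.
move=> hf; rewrite /entangled_output adjmxZ conjc_inv conjc_nat; congr (_ *: _).
rewrite adjmx_sum exchange_big; apply: eq_bigr => i _ /=.
rewrite adjmx_sum; apply: eq_bigr => j _ /=.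
by rewrite adjmx_tens hf !adjmx_ketbra.
Qed.

(* A maximally entangled state is stabilized by conj(X) (x) X; here conj(X) = X^T
   is transported to the bases V and W. *)
Definition entangled_partner (X : 'M[C]_d) : 'M[C]_d :=
  V *m (adjmx W *m X *m W)^T *m adjmx V.

Lemma entangled_partner_involution X :
  X *m X = 1%:M -> entangled_partner X *m entangled_partner X = 1%:M.
Proof.
move=> XX; rewrite /entangled_partner -!mulmxA (mulmxA (adjmx V) V).
rewrite unitary_adjmxl // mul1mx (mulmxA (_^T) (_^T)) -trmx_mul.
rewrite -!mulmxA (mulmxA W) unitary_adjmx // mul1mx (mulmxA X X) XX mul1mx.
by rewrite unitary_adjmxl // trmx1 mul1mx unitary_adjmx.
Qed.

Lemma adjmx_entangled_partner X :
  adjmx X = X -> adjmx (entangled_partner X) = entangled_partner X.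
Proof.
move=> hX; rewrite /entangled_partner.
have : adjmx (adjmx W *m X *m W) = adjmx W *m X *m W.
  by rewrite !adjmxM adjmxK hX mulmxA.
move: (adjmx W *m X *m W) => K hK; rewrite !adjmxM adjmxK mulmxA.
suff -> : adjmx K^T = K^T by [].
by rewrite -[in RHS]hK; apply/matrixP => i j; rewrite !mxE.
Qed.

Lemma mxtrace_entangled_partner X : \tr (entangled_partner X) = \tr X.
Proof.
rewrite /entangled_partner mxtrace_mulC mulmxA unitary_adjmxl // mul1mx.
by rewrite mxtrace_tr mxtrace_mulC mulmxA unitary_adjmx // mul1mx.
Qed.

Lemma entangled_partner1 : entangled_partner 1%:M = 1%:M.
Proof.
rewrite /entangled_partner mulmx1 unitary_adjmxl // trmx1 mulmx1.
exact: unitary_adjmx.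
Qed.

(** The hypothesis on [f] says that its dual sends Y to X. The expectation thus reduces to that of
    the partner of X tensored with X in Phi, which is tr (K^2) / d with K = W^* X W an
    involution. *)
Lemma mxtrace_entangled_output e (f : 'M[C]_d -> 'M[C]_e) (X : 'M[C]_d) (Y : 'M[C]_e) :
  (0 < d)%N -> X *m X = 1%:M -> (forall w, \tr (f w *m Y) = \tr (w *m X)) ->
  \tr (entangled_output f *m (entangled_partner X *t Y)) = 1.
Proof.
move=> d0 XX hf; rewrite /entangled_output -scalemxAl mxtraceZ mulmx_suml raddf_sum.
pose K := adjmx W *m X *m W.
have GK : adjmx V *m entangled_partner X *m V = K^T.
  rewrite /entangled_partner -/K -!mulmxA unitary_adjmxl // mulmx1.
  by rewrite mulmxA unitary_adjmxl // mul1mx.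
have KK : K *m K = 1%:M.
  rewrite /K -!mulmxA (mulmxA W) unitary_adjmx // mul1mx (mulmxA X X) XX mul1mx.
  exact: unitary_adjmxl.
have -> : \sum_(i < d) \tr ((\sum_(j < d)
    (ketbra (col i V) (col j V) *t f (ketbra (col i W) (col j W)))) *m
      (entangled_partner X *t Y)) = \tr (K *m K).
  (* The term (i, j) is K_ij K_ji: the transpose in the partner reverses the indices of the first
     factor. *)
  apply: eq_bigr => i _; rewrite mulmx_suml raddf_sum mxE; apply: eq_bigr => j _ /=.
  rewrite tensmx_mul tens_mxtrace mxtrace_ketbra_mul hf mxtrace_ketbra_mul.
  by rewrite !braket_col GK mxE.
by rewrite KK mxtrace1 mulVf // pnatr_eq0 -lt0n.
Qed.

(** By orthonormality of the columns of W, only the terms i = j survive, and the projectors onto the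
    columns of V sum to 1. *)
Lemma entangled_output_const e (f : 'M[C]_d -> 'M[C]_e) (E : 'M[C]_e) :
  (forall w, f w = \tr w *: E) -> entangled_output f = d%:R^-1 *: (1%:M *t E).
Proof.
move=> hf; congr (_ *: _); rewrite -(unitary_adjmx hV) -sum_ketbra_col tensmx_suml.
apply: eq_bigr => i _; rewrite (bigD1 i) //= big1 ?addr0 => [|j ji]; rewrite hf.
  rewrite -[ketbra (col i W) _]mulmx1 mxtrace_ketbra_mul mul1mx -[col i W]mul1mx.
  by rewrite {1}mul1mx braket_col mulmx1 unitary_adjmxl // mxE eqxx scale1r.
rewrite -[ketbra (col i W) _]mulmx1 mxtrace_ketbra_mul.
by rewrite braket_col mulmx1 unitary_adjmxl // mxE (negPf ji) scale0r tensmx0.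
Qed.

(** Use the projection P = 1, for which tr (1 (x) sigma) = d. *)
Lemma condH2_entangled_output_le e (f : 'M[C]_d -> 'M[C]_e) :
  (0 < d)%N -> (forall X, adjmx (f X) = f (adjmx X)) -> trace_preserving f ->
  (condH2 (entangled_output f) <= (log2 d%:R)%:E)%E.
Proof.
move=> d0 hf trf; apply: (@condH2_le _ _ _ _ 1%:M).
- exact: adjmx_entangled_output.
- exact: adjmx1.
- by rewrite mulmx1.
- rewrite -tensmx11 -entangled_partner1; apply: mxtrace_entangled_output => //.
    by rewrite mulmx1.
  by move=> w; rewrite !mulmx1.
- by rewrite ltr0n.
- by move=> sigma trs; rewrite mul1mx tens_mxtrace trs mulr1 mxtrace1 rmorph_nat.
Qed.

(** Use P = (1 + G) / 2, the projection onto the +1 eigenspace of the stabilizer G. Its second half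
    contributes nothing to tr (P (1 (x) sigma)) because the partner of X is traceless, which leaves
    d / 2 = 1. *)
Lemma condH2_entangled_output_le0 e (f : 'M[C]_d -> 'M[C]_e) (X : 'M[C]_d) (Y : 'M[C]_e) :
  d = 2 -> (forall X, adjmx (f X) = f (adjmx X)) -> trace_preserving f ->
  adjmx X = X -> X *m X = 1%:M -> \tr X = 0 ->
  adjmx Y = Y -> Y *m Y = 1%:M -> (forall w, \tr (f w *m Y) = \tr (w *m X)) ->
  (condH2 (entangled_output f) <= 0)%E.
Proof.
move=> d2 hf trf hX XX trX hY YY hXY.
pose G := entangled_partner X *t Y.
have GG : G *m G = 1%:M.
  by rewrite tensmx_mul entangled_partner_involution // YY tensmx11.
have hG : adjmx G = G by rewrite adjmx_tens adjmx_entangled_partner // hY.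
have d0 : (0 < d)%N by rewrite d2.
have <- : (log2 (1 : R))%:E = 0%E by rewrite /log2 ln1 mul0r.
apply: (@condH2_le _ _ _ _ (2^-1 *: (1%:M + G))).
- exact: adjmx_entangled_output.
- by rewrite adjmxZ adjmxD adjmx1 hG conjc_inv conjc_nat.
- rewrite -scalemxAl -scalemxAr scalerA mulmxDl mul1mx mulmxDr mulmx1 GG.
  rewrite (addrC G); set M := 1%:M + G.
  have -> : M + M = 2%:R *: M by rewrite scaler_nat.
  by rewrite scalerA; congr (_ *: _); field.
- rewrite -scalemxAr mulmxDr mxtraceZ mxtraceD mxtrace_entangled_output //.
  rewrite -tensmx11 -entangled_partner1 mxtrace_entangled_output //.
  + by field.
  + by rewrite mulmx1.
  + by move=> w; rewrite !mulmx1.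
- exact: ltr01.
- move=> sigma trs; rewrite -scalemxAl mulmxDl mul1mx mxtraceZ mxtraceD.
  rewrite /G tensmx_mul mulmx1 !tens_mxtrace mxtrace_entangled_partner trX mul0r.
  by rewrite trs mxtrace1 d2; field.
Qed.

End MaximallyEntangled.

(** * The value 1 for a maximally mixed qubit tensored with a pure one *)

Section EntropyAttained.
Variable R : realType.
Local Notation C := R[i].

Lemma posdef_diag d (x : 'rV[R]_d) : (forall i, 0 < x 0 i) ->
  posdef (diag_mx (map_mx (real_complex R) x)).
Proof.
move=> x0.
have mul_diag (y z w : 'rV[R]_d) : (forall i, y 0 i * z 0 i = w 0 i) ->
    diag_mx (map_mx (real_complex R) y) *m diag_mx (map_mx (real_complex R) z) =
    diag_mx (map_mx (real_complex R) w).
  move=> yz; rewrite mulmx_diag; congr diag_mx.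
  by apply/rowP => i; rewrite !mxE -rmorphM /= yz.
pose D := diag_mx (map_mx (real_complex R) (map_mx Num.sqrt x)).
pose N := diag_mx (map_mx (real_complex R) (map_mx (fun r => (Num.sqrt r)^-1) x)).
have sx i : Num.sqrt (x 0 i) != 0 by rewrite gt_eqF // sqrtr_gt0.
rewrite -(mul_diag (map_mx Num.sqrt x) (map_mx Num.sqrt x)); last first.
  by move=> i; rewrite !mxE -expr2 sqr_sqrtr // ltW.
rewrite -{1}adjmx_diag_real; apply: (@posdef_mulmx_adj _ _ D N).
rewrite /N /D (mul_diag _ _ (const_mx 1)); last by move=> i; rewrite !mxE mulVf.
by apply/matrixP => i j; rewrite !mxE rmorph1.
Qed.

Lemma tens1_diag m n (x : 'rV[C]_n) :
  (1%:M : 'M[C]_m) *t diag_mx x = diag_mx (\row_k x 0 (mxtens_unindex k).2).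
Proof.
apply/matrixP => i j; case: (mxtens_indexP i) => i1 i2.
case: (mxtens_indexP j) => j1 j2.
rewrite tensmxE !mxE mxtens_indexK /= (inj_eq (can_inj (@mxtens_indexK _ _))).
rewrite xpair_eqE; case: eqP => _; case: eqP => _;
  by rewrite ?mul1r ?mul0r ?mulr1n ?mulr0n ?mulr0.
Qed.

Lemma mxpowR_tens1_diag m n (x : 'rV[R]_n) s : (forall i, 0 < x 0 i) ->
  mxpowR ((1%:M : 'M[C]_m) *t diag_mx (map_mx (real_complex R) x)) s =
  1%:M *t diag_mx (map_mx (fun r => (r `^ s)%:C%C) x).
Proof.
move=> x0; rewrite !tens1_diag.
have -> : (\row_k (map_mx (real_complex R) x) 0 (@mxtens_unindex m n k).2) =
    map_mx (real_complex R) (\row_k x 0 (mxtens_unindex k).2).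
  by apply/rowP => k; rewrite !mxE.
rewrite mxpowR_diag; last by move=> i; rewrite mxE.
by congr diag_mx; apply/rowP => k; rewrite !mxE.
Qed.

(* sigma = diag (t, 1 - t) gives 1 + log2 t, and t -> 1: the supremum is not
   attained. *)
Lemma condH2_maxmixed_pure_ge :
  (1%:E <= condH2 (2%:R^-1 *: ((1%:M : 'M[C]_2) *t (delta_mx 0 0 : 'M[C]_2)))%R)%E.
Proof.
apply/lee_addgt0Pr => e e0; rewrite -leeBlDr // -EFinB.
(* t = 2^(-e), so that 1 + log2 t = 1 - e. *)
pose t : R := expR (- e * ln 2).
have ln20 := ln2_gt0 R.
have t0 : 0 < t := expR_gt0 _.
have t1 : t < 1 by rewrite -expR0 ltr_expR; nra.
have lnt : ln t = - e * ln 2 := expRK _.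
pose x : 'rV[R]_2 := \row_i (if i == 0 then t else 1 - t).
have x0 i : 0 < x 0 i by rewrite mxE; case: ifP => _; lra.
apply: ereal_sup_ubound; exists (diag_mx (map_mx (real_complex R) x)) => /=.
  split; first exact: posdef_diag.
  rewrite mxtrace_diag big_ord_recl big_ord1 !mxE /= -rmorphD /=.
  by rewrite addrC subrK.
rewrite mxpowR_tens1_diag //; congr (_%:E).
set D := diag_mx _; set k : R := t `^ (- 4^-1).
have DED : D *m delta_mx 0 0 *m D = (k ^+ 2)%:C%C *: delta_mx 0 0.
  apply/matrixP => i j; rewrite mul_mx_diag mul_diag_mx !mxE.
  have [_|_] := eqVneq i 0; last by rewrite ?andbF mulr0 mul0r mulr0.
  have [_|_] := eqVneq j 0; last by rewrite ?andbF mulr0 mul0r mulr0.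
  by rewrite /= !mulr1 -rmorphM /= expr2.
have -> : 1%:M *t D *m (2%:R^-1 *: (1%:M *t delta_mx 0 0)) *m (1%:M *t D) =
    (2%:R^-1 * (k ^+ 2)%:C%C) *: ((1%:M : 'M[C]_2) *t delta_mx 0 0).
  rewrite -scalemxAr -scalemxAl !tensmx_mul !mulmx1 DED tensmxZr scalerA.
  by [].
have EE : ((1%:M : 'M[C]_2) *t (delta_mx 0 0 : 'M[C]_2)) *m
    ((1%:M : 'M[C]_2) *t (delta_mx 0 0 : 'M[C]_2)) = 1%:M *t delta_mx 0 0.
  by rewrite tensmx_mul mulmx1 mul_delta_mx.
rewrite expr2 -mulmxE -scalemxAl -scalemxAr scalerA EE mxtraceZ tens_mxtrace mxtrace1.
have -> : \tr (delta_mx 0 0 : 'M[C]_2) = 1.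
  by rewrite /mxtrace big_ord_recl big_ord1 !mxE /= addr0.
have k4 : k ^+ 2 * k ^+ 2 = t^-1.
  rewrite -exprD -powR_mulrn ?powR_ge0 // -powRrM.
  by rewrite (_ : - 4^-1 * 4%:R = -1) ?powR_inv1 ?ltW //; field.
have -> : 2%:R^-1 * (k ^+ 2)%:C%C * (2%:R^-1 * (k ^+ 2)%:C%C) * (2%:R * 1) =
    (2^-1 * t^-1)%:C%C :> C.
  rewrite -k4 !rmorphM /= fmorphV rmorph_nat; by field.
rewrite /= /log2 lnM ?posrE ?invr_gt0 // !lnV ?posrE // lnt.
by field; rewrite gt_eqF.
Qed.

End EntropyAttained.

(** * Block structure of the two-qubit unitary and its complementary channel *)

Section TwoQubit.
Variable R : realType.
Local Notation C := R[i].

(** Duality of the partial trace with Y |-> 1 (x) Y; it moves expectations on F to the joint output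
    BF. *)
Lemma mxtrace_ptrace1_mul m n (X : 'M[C]_(m * n)) (Y : 'M[C]_n) :
  \tr (ptrace1 X *m Y) = \tr (X *m (1%:M *t Y)).
Proof.
rewrite /mxtrace sum_mxtens_index exchange_big; apply: eq_bigr => i _ /=.
rewrite mxE.
under [LHS]eq_bigr => j _ do rewrite mxE mulr_suml.
rewrite exchange_big; apply: eq_bigr => k _ /=.
rewrite mxE sum_mxtens_index (bigD1 k) //= [X in _ + X]big1 ?addr0.
  by apply: eq_bigr => j _; rewrite tensmxE mxE eqxx mul1r.
by move=> l lk; apply: big1 => j _; rewrite tensmxE mxE (negPf lk) mul0r mulr0.
Qed.

Lemma adjmx_ptrace1 m n (X : 'M[C]_(m * n)) : adjmx (ptrace1 X) = ptrace1 (adjmx X).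
Proof.
apply/matrixP => i j; rewrite !mxE rmorph_sum; apply: eq_bigr => k _.
by rewrite !mxE.
Qed.

Lemma ptrace1_linear m n : linear (@ptrace1 R m n).
Proof.
move=> a X Y; apply/matrixP => i j; rewrite !mxE mulr_sumr -big_split.
by apply: eq_bigr => k _; rewrite !mxE.
Qed.

HB.instance Definition _ m n :=
  GRing.isLinear.Build C _ _ _ (@ptrace1 R m n) (@ptrace1_linear m n).

Fact channelNc_linear (alpha : R * R * R) (phi : 'M[C]_2) :
  linear (channelNc alpha phi).
Proof.
move=> a X Y; rewrite /channelNc /Uconj.
rewrite (_ : phi *t (a *: X + Y) = a *: (phi *t X) + phi *t Y).
  by rewrite -!/(mxconj _ _) !linearP.
by apply/matrixP => i j; rewrite !mxE; ring.
Qed.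

HB.instance Definition _ (alpha : R * R * R) (phi : 'M[C]_2) :=
  GRing.isLinear.Build C _ _ _ (channelNc alpha phi) (channelNc_linear alpha phi).

(** Entries between basis vectors of different parity vanish. The even block on |00>, |11> is ((a,
    b), (b, a)), the odd block on |01>, |10> is ((c, d), (d, c)). *)
Definition parity_block (U : 'M[C]_(2 * 2)) (a b c d : C) : Prop :=
  forall i k j l : 'I_2, U (mxtens_index (i, k)) (mxtens_index (j, l)) =
    if (i == k) != (j == l) then 0
    else if i == j then if i == k then a else c
    else if i == k then b else d.

Lemma Ualpha_parity_block (ax ay az : R) :
  parity_block (Ualpha (ax, ay, az))
    (cos ((ax - ay) / 2))%:C%C
    (- Complex 0 1 * (sin ((ax - ay) / 2))%:C%C)
    (expi az * (cos ((ax + ay) / 2))%:C%C)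
    (- Complex 0 1 * expi az * (sin ((ax + ay) / 2))%:C%C).
Proof.
move=> i k j l; rewrite mxE.
case: i => [[|[|//]] hi]; case: k => [[|[|//]] hk];
case: j => [[|[|//]] hj]; case: l => [[|[|//]] hl] //.
Qed.

(** The hypotheses say that each of the two blocks has orthonormal columns. *)
Lemma parity_block_unitary U a b c d : parity_block U a b c d ->
  conjc a * a + conjc b * b = 1 -> conjc a * b + conjc b * a = 0 ->
  conjc c * c + conjc d * d = 1 -> conjc c * d + conjc d * c = 0 ->
  adjmx U *m U = 1%:M.
Proof.
(* Conjugating a zero entry computes to this literal. *)
have c0 : Complex 0 (- 0) = 0 :> C by rewrite oppr0.
move=> UE aa ab cc cd; apply/matrixP => x y; rewrite -(tensmx11 R 2 2).
case: (mxtens_indexP x) => i k; case: (mxtens_indexP y) => j l.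
rewrite tensmxE mxE sum_mxtens_index !big_ord_recl !big_ord0 !mxE !UE.
case: i => [[|[|//]] hi]; case: k => [[|[|//]] hk];
case: j => [[|[|//]] hj]; case: l => [[|[|//]] hl];
by rewrite /= ?c0 ?mul0r ?mulr0 ?addr0 ?add0r ?mulr1 // addrC.
Qed.

Lemma Ualpha_unitary (alpha : R * R * R) :
  adjmx (Ualpha alpha) *m Ualpha alpha = 1%:M.
Proof.
case: alpha => [[ax ay] az]; have UE := Ualpha_parity_block ax ay az.
have ee : cos az ^+ 2 + sin az ^+ 2 = 1 := cos2Dsin2 az.
apply: (parity_block_unitary UE);
  apply/eqP; rewrite eq_complex /expi /=; apply/andP; split; apply/eqP.
- have := cos2Dsin2 ((ax - ay) / 2); move: (cos _) (sin _) => p q; nra.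
- ring.
- ring.
- ring.
- have := cos2Dsin2 ((ax + ay) / 2); move: (cos (_ / 2)) (sin (_ / 2)) => p q.
  move: ee; move: (cos az) (sin az) => u v ee pq.
  (* The squared column norm in the odd block is |e^(i az)|^2 (cos^2 + sin^2). *)
  transitivity ((u ^+ 2 + v ^+ 2) * (p ^+ 2 + q ^+ 2)); first by ring.
  by rewrite ee pq mulr1.
- ring.
- ring.
- ring.
Qed.

Lemma pure_state_adjmx d (phi : 'M[C]_d) : pure_state phi -> adjmx phi = phi.
Proof. by case=> v _ ->; exact: adjmx_ketbra. Qed.

Lemma pure_state_mxtrace d (phi : 'M[C]_d) : pure_state phi -> \tr phi = 1.
Proof.
by case=> v vv ->; rewrite -[ketbra v v]mulmx1 mxtrace_ketbra_mul mul1mx.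
Qed.

Lemma adjmx_channelNc alpha (phi : 'M[C]_2) : adjmx phi = phi ->
  forall X, adjmx (channelNc alpha phi X) = channelNc alpha phi (adjmx X).
Proof.
move=> hphi X; rewrite /channelNc adjmx_ptrace1 /Uconj !adjmxM adjmxK adjmx_tens.
by rewrite hphi mulmxA.
Qed.

(** By duality the left side is the expectation of U^* (1 (x) X) U in phi (x) w; commutation turns
    this observable back into 1 (x) X, and phi contributes its trace. *)
Lemma mxtrace_channelNc_mul alpha (phi X w : 'M[C]_2) : \tr phi = 1 ->
  (1%:M *t X) *m Ualpha alpha = Ualpha alpha *m (1%:M *t X) ->
  \tr (channelNc alpha phi w *m X) = \tr (w *m X).
Proof.
move=> trphi XU; have UU := Ualpha_unitary alpha.
rewrite /channelNc mxtrace_ptrace1_mul /Uconj mxtrace_mulC !mulmxA XU.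
rewrite mxtrace_mulC -!mulmxA (mulmxA (adjmx _)) UU mul1mx tensmx_mul mul1mx.
by rewrite tens_mxtrace trphi mul1r mxtrace_mulC.
Qed.

(** The case X = 1 of the preceding identity. *)
Lemma channelNc_trace_preserving alpha (phi : 'M[C]_2) :
  \tr phi = 1 -> trace_preserving (channelNc alpha phi).
Proof.
move=> trphi w; have := @mxtrace_channelNc_mul alpha phi 1%:M w trphi.
by rewrite !mulmx1 tensmx11 mulmx1 mul1mx; apply.
Qed.

Definition pauliX : 'M[C]_2 := \matrix_(i, j) (i != j)%:R.

Lemma adjmx_pauliX : adjmx pauliX = pauliX.
Proof. by apply/matrixP => i j; rewrite !mxE conjc_nat eq_sym. Qed.

Lemma pauliX_sqr : pauliX *m pauliX = 1%:M.
Proof.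
apply/matrixP => i j; rewrite !mxE big_ord_recl big_ord1 !mxE.
case: i => [[|[|//]] hi]; case: j => [[|[|//]] hj];
by rewrite /= ?mul0r ?mulr0 ?addr0 ?add0r ?mulr1.
Qed.

Lemma mxtrace_pauliX : \tr pauliX = 0.
Proof. by apply: big1 => i _; rewrite mxE eqxx. Qed.

(** With equal blocks U = a (1 (x) 1) + b (X (x) X), where X is the Pauli matrix. *)
Lemma parity_block_pauliX_comm U a b : parity_block U a b a b ->
  (1%:M *t pauliX) *m U = U *m (1%:M *t pauliX).
Proof.
move=> UE; apply/matrixP => x y.
case: (mxtens_indexP x) => i k; case: (mxtens_indexP y) => j l.
rewrite !mxE !sum_mxtens_index !big_ord_recl !big_ord0 !tensmxE !mxE !UE.
case: i => [[|[|//]] hi]; case: k => [[|[|//]] hk];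
case: j => [[|[|//]] hj]; case: l => [[|[|//]] hl];
by rewrite /= !(mul1r, mulr1, mul0r, mulr0, addr0, add0r).
Qed.

(** For alpha_y = alpha_z = 0 both blocks have angle ax / 2 and the odd block has phase 1, so they
    coincide. *)
Lemma Ualpha_pauliX_comm (ax : R) :
  (1%:M *t pauliX) *m Ualpha (ax, 0, 0) = Ualpha (ax, 0, 0) *m (1%:M *t pauliX).
Proof.
have := Ualpha_parity_block ax 0 0.
have -> : expi 0 = 1 :> C by rewrite /expi cos0 sin0.
by rewrite subr0 addr0 mulr1 mul1r; apply: parity_block_pauliX_comm.
Qed.

End TwoQubit.

(** * Unitaries that swap the two qubits up to a phase *)

Section SwapType.
Variable R : realType.
Local Notation C := R[i].

Lemma mxconjE m n (V : 'M[C]_(m, n)) A i j :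
  mxconj V A i j = \sum_k \sum_l V i k * A k l * conjc (V j l).
Proof.
rewrite mxE exchange_big; apply: eq_bigr => l _.
by rewrite !mxE mulr_suml.
Qed.

Lemma mxconj_tens_ket0 (U : 'M[C]_(2 * 2)) (w : 'M[C]_2) x y :
  mxconj U (ket0bra0 *t w) x y =
  \sum_k \sum_l U x (mxtens_index (0, k)) * w k l *
    conjc (U y (mxtens_index (0, l))).
Proof.
rewrite mxconjE sum_mxtens_index [LHS](bigD1 0) //= [X in _ + X]big1 ?addr0; last first.
  move=> i i0; apply: big1 => k _; apply: big1 => l _.
  case: (mxtens_indexP l) => l1 l2.
  by rewrite tensmxE mxE (negPf i0) mul0r mulr0 mul0r.
apply: eq_bigr => k _; rewrite sum_mxtens_index [LHS](bigD1 0) //=.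
rewrite [X in _ + X]big1 ?addr0; last first.
  move=> i i0; apply: big1 => l _.
  by rewrite tensmxE mxE (negPf i0) andbF mul0r mulr0 mul0r.
by apply: eq_bigr => l _; rewrite tensmxE mxE !eqxx mul1r.
Qed.

Definition phase_gate (s : C) : 'M[C]_2 :=
  \matrix_(i, j) (if i == j then (if i == 0 then 1 else s) else 0).

Lemma phase_gate_unitary s : conjc s * s = 1 ->
  adjmx (phase_gate s) *m phase_gate s = 1%:M.
Proof.
have c0 : Complex 0 (- 0) = 0 :> C by rewrite oppr0.
have c1 : Complex 1 (- 0) = 1 :> C by rewrite oppr0.
move=> ss; apply/matrixP => i j; rewrite !mxE !big_ord_recl !big_ord0 !mxE.
case: i => [[|[|//]] hi]; case: j => [[|[|//]] hj];
by rewrite /= !(c0, c1, ss, mul1r, mulr1, mul0r, mulr0, addr0, add0r).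
Qed.

Variables (alpha : R * R * R) (s : C).
Hypotheses (UE : parity_block (Ualpha alpha) 1 0 0 s) (ss : conjc s * s = 1).

(** U maps |0>|k> to s^k |k>|0>: B receives the input up to the diagonal gate diag (1, s). *)
Lemma channelN_ket0_swap : channelN alpha ket0bra0 = mxconj (phase_gate s).
Proof.
have c0 : Complex 0 (- 0) = 0 :> C by rewrite oppr0.
have c1 : Complex 1 (- 0) = 1 :> C by rewrite oppr0.
apply/funext => w; apply/matrixP => i j; rewrite mxconjE mxE /Uconj.
under eq_bigr => k _ do rewrite -/(mxconj _ _) mxconj_tens_ket0.
rewrite !big_ord_recl !big_ord0 !UE !mxE.
case: i => [[|[|//]] hi]; case: j => [[|[|//]] hj];
by rewrite /= !(c0, c1, mul1r, mulr1, mul0r, mulr0, addr0, add0r).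
Qed.

(** As U maps |0>|k> to s^k |k>|0>, F always ends in |0>. *)
Lemma channelNc_ket0_swap w : channelNc alpha ket0bra0 w = \tr w *: delta_mx 0 0.
Proof.
have c0 : Complex 0 (- 0) = 0 :> C by rewrite oppr0.
have c1 : Complex 1 (- 0) = 1 :> C by rewrite oppr0.
apply/matrixP => i j; rewrite mxE /Uconj.
under eq_bigr => k _ do rewrite -/(mxconj _ _) mxconj_tens_ket0.
rewrite /mxtrace !big_ord_recl !big_ord0 !UE !mxE.
(* The phase and its conjugate cancel in the diagonal term k = 1. *)
have sws x : s * x * conjc s = x by rewrite mulrAC (mulrC s) ss mul1r.
case: i => [[|[|//]] hi]; case: j => [[|[|//]] hj];
by rewrite /= !(c0, c1, sws, mul1r, mulr1, mul0r, mulr0, addr0, add0r).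
Qed.

End SwapType.

(** * The four gates and the resulting capacity bound *)

Section Cases.
Variable R : realType.
Local Notation C := R[i].

Lemma SWAP_parity_block : parity_block (Ualpha (@alpha_SWAP R)) 1 0 0 1.
Proof.
have := Ualpha_parity_block (pi / 2) (pi / 2) (pi / 2 : R).
rewrite subrr mul0r cos0 sin0 -splitr cos_pihalf sin_pihalf !mulr0 !mulr1.
(* -i e^(i pi / 2) = 1, so SWAP carries no phase; DCNOT, with alpha_z = 0, keeps s = -i. *)
suff -> : - Complex 0 1 * expi (pi / 2) = 1 :> C by [].
rewrite /expi cos_pihalf sin_pihalf; apply/eqP; rewrite eq_complex /=.
by apply/andP; split; apply/eqP; ring.
Qed.

Lemma DCNOT_parity_block :
  parity_block (Ualpha (@alpha_DCNOT R)) 1 0 0 (- Complex 0 1).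
Proof.
have := Ualpha_parity_block (pi / 2) (pi / 2) (0 : R).
rewrite subrr mul0r cos0 sin0 -splitr cos_pihalf sin_pihalf !mulr0 !mulr1.
suff -> : expi 0 = 1 :> C by rewrite mulr1.
by rewrite /expi cos0 sin0.
Qed.

Lemma conjNi_mulNi : conjc (- Complex 0 1) * (- Complex 0 1) = 1 :> C.
Proof.
by apply/eqP; rewrite eq_complex /=; apply/andP; split; apply/eqP; ring.
Qed.

Lemma SWAP_DCNOT_phase (alpha : R * R * R) :
  alpha = alpha_SWAP \/ alpha = alpha_DCNOT ->
  exists2 s : C, conjc s * s = 1 & parity_block (Ualpha alpha) 1 0 0 s.
Proof.
case=> ->.
  by exists 1; [rewrite rmorph1 mul1r | exact: SWAP_parity_block].
by exists (- Complex 0 1); [exact: conjNi_mulNi | exact: DCNOT_parity_block].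
Qed.

Variable Phi : 'M[C]_(2 * 2).
Hypothesis hPhi : maximally_entangled Phi.

(** The bases come from Phi alone, so one choice serves all alpha and phi. *)
Lemma rhoBF_entangled : exists V W : 'M[C]_2, [/\ V \is unitarymx,
  W \is unitarymx & forall alpha phi,
    rhoBF alpha phi Phi = entangled_output V W (channelNc alpha phi)].
Proof.
have [V [W [hV hW ->]]] := hPhi; exists V, W; split=> // alpha phi.
exact: (tens_map_entangled V W (channelNc alpha phi)).
Qed.

Lemma condH2_rhoBF_le1 (alpha : R * R * R) (phi : 'M[C]_2) : pure_state phi ->
  (condH2 (rhoBF alpha phi Phi) <= 1)%E.
Proof.
move=> hphi; have [V [W [hV hW ->]]] := rhoBF_entangled.
have <- : (log2 (2%:R : R))%:E = 1%E by rewrite /log2 divff // gt_eqF // ln2_gt0.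
apply: condH2_entangled_output_le => //.
  exact/adjmx_channelNc/pure_state_adjmx.
exact/channelNc_trace_preserving/pure_state_mxtrace.
Qed.

(** Identity and CNOT are the cases ax = 0 and ax = pi / 2; the Pauli matrix X serves as both
    observables. *)
Lemma condH2_rhoBF_le0 (ax : R) (phi : 'M[C]_2) : pure_state phi ->
  (condH2 (rhoBF (ax, 0%R, 0%R) phi Phi) <= 0)%E.
Proof.
move=> hphi; have [V [W [hV hW ->]]] := rhoBF_entangled.
have trphi := pure_state_mxtrace hphi.
apply: (@condH2_entangled_output_le0 _ _ _ _ hV hW _ _ (pauliX R) (pauliX R)) => //.
- exact/adjmx_channelNc/pure_state_adjmx.
- exact: channelNc_trace_preserving.
- exact: adjmx_pauliX.
- exact: pauliX_sqr.
- exact: mxtrace_pauliX.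
- exact: adjmx_pauliX.
- exact: pauliX_sqr.
- by move=> w; apply: mxtrace_channelNc_mul => //; exact: Ualpha_pauliX_comm.
Qed.

Lemma pure_state_ket0 : pure_state (@ket0bra0 R).
Proof.
exists (delta_mx 0 0).
  by rewrite /braket adjmx_delta mul_delta_mx mxE.
by rewrite /ketbra adjmx_delta mul_delta_mx.
Qed.

(** The upper bound is the one valid for every channel; the lower bound uses that the complement is
    constant, which makes rho equal to (1 / 2) (x) |0><0|. *)
Lemma condH2_rhoBF_ket0 (alpha : R * R * R) :
  alpha = alpha_SWAP \/ alpha = alpha_DCNOT ->
  condH2 (rhoBF alpha ket0bra0 Phi) = 1%E.
Proof.
move=> /SWAP_DCNOT_phase [s ss UE]; apply/eqP; rewrite eq_le.
rewrite (condH2_rhoBF_le1 _ pure_state_ket0) /=.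
have [V [W [hV hW ->]]] := rhoBF_entangled.
rewrite (entangled_output_const hV hW (channelNc_ket0_swap UE ss)).
exact: condH2_maxmixed_pure_ge.
Qed.

End Cases.

Lemma oneshotQ_ket0_ge (R : realType) (alpha : R * R * R) (eps : R) n :
  alpha = alpha_SWAP \/ alpha = alpha_DCNOT -> 0 <= eps ->
  (n.+1%:R%:E <= oneshotQ (tens_pow (channelN alpha ket0bra0) n.+1) eps)%E.
Proof.
move=> /SWAP_DCNOT_phase [s ss UE] eps0; rewrite (channelN_ket0_swap UE).
have := @oneshotQ_tens_pow_unitary R 2 _ eps n isT eps0 (phase_gate_unitary ss).
by rewrite /log2 divff ?mulr1 // gt_eqF // ln2_gt0.
Qed.

Theorem mainTheorem2 (R : realType) (Phi : 'M[R[i]]_(2 * 2))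
    (hPhi : maximally_entangled Phi) :
  [/\ forall phi : 'M[R[i]]_2, pure_state phi ->
        (condH2 (rhoBF alpha_Identity phi Phi) <= 0)%E,
      forall phi : 'M[R[i]]_2, pure_state phi ->
        (condH2 (rhoBF alpha_CNOT phi Phi) <= 0)%E,
      (forall phi : 'M[R[i]]_2, pure_state phi ->
        (condH2 (rhoBF alpha_SWAP phi Phi) <= 1)%E) /\
      condH2 (rhoBF alpha_SWAP ket0bra0 Phi) = 1%E,
      (forall phi : 'M[R[i]]_2, pure_state phi ->
        (condH2 (rhoBF alpha_DCNOT phi Phi) <= 1)%E) /\
      condH2 (rhoBF alpha_DCNOT ket0bra0 Phi) = 1%E
    & forall (alpha : R * R * R) (eps : R) (n : nat),
        alpha = alpha_SWAP \/ alpha = alpha_DCNOT ->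
        0 < eps <= 2 -> (1 <= n)%N ->
        (exists delta, delta_minimizer eps delta) /\
        forall delta, delta_minimizer eps delta ->
          ((n%:R^-1)%:E * oneshotQ (tens_pow (channelN alpha ket0bra0) n) eps
           >= (1 - n%:R^-1 * gfun (Num.sqrt (eps / 2) - delta)
               - 4 / n%:R * log2 delta^-1 - 2 / n%:R)%:E)%E].
Proof.
split.
- exact: (condH2_rhoBF_le0 hPhi 0).
- exact: (condH2_rhoBF_le0 hPhi (pi / 2)).
- split; first exact: (condH2_rhoBF_le1 hPhi).
  by apply: (condH2_rhoBF_ket0 hPhi); left.
- split; first exact: (condH2_rhoBF_le1 hPhi).
  by apply: (condH2_rhoBF_ket0 hPhi); right.
move=> alpha eps [//|n] halpha heps _; split; first exact: delta_minimizer_exists.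
move=> delta [hdelta _]; apply: capacity_bound_of_rate1 => //.
by apply: oneshotQ_ket0_ge => //; case/andP: heps => /ltW.
Qed.
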